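(* Let $\varepsilon>0$ and let $p=p(n)\in(0,1/2]$ be a function on the natural numbers such that $p\ge n^{-1/4+\varepsilon}$ for all sufficiently large $n$. Let $\chi$ be a random $(p,1-p)$-colouring of the hypercube $Q_n$. Then with high probability, $\chi$ is $2$-distinguishable.
   Context: $Q_n$ is the $n$-dimensional hypercube: vertex set $\{0,1\}^n$, two vertices adjacent iff they differ in exactly one coordinate. A random $(p,1-p)$-colouring of $Q_n$ is an independent family $(\chi(v))_{v\in V(Q_n)}$ of random variables with $\mathbb{P}[\chi(v)=0]=p$ and $\mathbb{P}[\chi(v)=1]=1-p$. ''With high probability'' means with probability tending to $1$ as $n\to\infty$. For a vertex $v$, $B_r(v)$ is the subgraph induced by the vertices at graph distance at most $r$ from $v$, and $\chi^{(r)}(v)=\chi|_{B_r(v)}$. Colourings $\chi$ of a graph $G$ and $\lambda$ of a graph $H$ are equivalent, $\chi\cong\lambda$, if there is a graph isomorphism $\phi:G\to H$ with $\chi=\lambda\circ\phi$. Colourings $\chi,\lambda$ of $V(Q_n)$ are $r$-locally equivalent, $\chi\cong_r\lambda$, if there is a bijection $f:V(Q_n)\to V(Q_n)$ with $\chi^{(r)}(v)\cong\lambda^{(r)}(f(v))$ for all $v$. A colouring $\chi$ is $r$-distinguishable if there is no colouring $\lambda$ of $V(Q_n)$ with $\chi\cong_r\lambda$ but $\chi\not\cong\lambda$. *)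

(* Defs.v *)
From HB Require Import structures.
From mathcomp Require Import all_boot all_order all_algebra.
From mathcomp Require Import all_classical all_reals all_analysis.

Set Implicit Arguments.
Unset Strict Implicit.
Unset Printing Implicit Defensive.

Import Order.TTheory GRing.Theory Num.Theory.
Import numFieldNormedType.Exports.

Local Open Scope classical_set_scope.
Local Open Scope ring_scope.

Record sgraph := SGraph {
  vertex :> finType;
  adj : rel vertex;
  adj_sym : symmetric adj;
  adj_irrefl : irreflexive adj }.

Arguments adj {s} : rename.

Section Induced.
Variables (G : sgraph) (S : {set G}).

Let iadj : rel {x : G | x \in S} := fun x y => adj (val x) (val y).

Let iadj_sym : symmetric iadj.
Proof. by move=> x y; exact: adj_sym. Qed.

Let iadj_irrefl : irreflexive iadj.
Proof. by move=> x; exact: adj_irrefl. Qed.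

Definition induced : sgraph := SGraph iadj_sym iadj_irrefl.

End Induced.

(* The vertices at distance at most r from v: the ends of the walks from v
   with at most r edges. *)
Definition ball_set (G : sgraph) (r : nat) (v : G) : {set G} :=
  [set u | [exists k : 'I_r.+1, exists s : k.-tuple G,
              path adj v s && (last v s == u)]]%SET.

Definition cball (G : sgraph) (r : nat) (v : G) : sgraph :=
  induced (ball_set r v).

Definition graph_iso (G H : sgraph) (phi : G -> H) : Prop :=
  bijective phi /\ forall x y : G, adj (phi x) (phi y) = adj x y.

Section Colourings.
Variable C : Type.

Definition col_equiv (G H : sgraph) (chi : G -> C) (lambda : H -> C) : Prop :=
  exists phi : G -> H, graph_iso phi /\ chi = lambda \o phi.

Definition local_col (G : sgraph) (r : nat) (chi : G -> C) (v : G) :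
  cball r v -> C := fun x => chi (val x).

(* The isomorphisms between balls need not map centre to centre. *)
Definition locally_equiv (G : sgraph) (r : nat) (chi lambda : G -> C) : Prop :=
  exists f : G -> G, bijective f /\
    forall v : G, col_equiv (local_col (r := r) chi (v := v))
                            (local_col (r := r) lambda (v := f v)).

Definition distinguishable (G : sgraph) (r : nat) (chi : G -> C) : Prop :=
  ~ exists lambda : G -> C,
      locally_equiv r chi lambda /\ ~ col_equiv chi lambda.

End Colourings.

Section Hypercube.
Variable n : nat.

Let qadj : rel {ffun 'I_n -> bool} := fun u v => #|[pred i | u i != v i]| == 1%N.

Let qadj_sym : symmetric qadj.
Proof.
move=> u v; rewrite /qadj; congr (_ == _).
by apply: eq_card => i; rewrite !inE eq_sym.
Qed.

Let qadj_irrefl : irreflexive qadj.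
Proof. by move=> u; rewrite /qadj eq_card0// => i; rewrite !inE eqxx. Qed.

Definition hypercube : sgraph := SGraph qadj_sym qadj_irrefl.

End Hypercube.

Section Probability.
Context {d d' : measure_display} {T : measurableType d} {T' : measurableType d'}.
Context {R : realType} (P : probability T R).

Definition mutually_independent (I : finType) (X : I -> {RV P >-> T'}) : Prop :=
  forall (J : {set I}) (A : I -> set T'), (forall i, measurable (A i)) ->
    P (\bigcap_(i in [set` J]) (X i @^-1` A i)) =
      (\prod_(i in J) P (X i @^-1` A i))%E.

End Probability.

(* Colour 0 is false and colour 1 is true. *)
Definition random_colouring (d : measure_display) (T : measurableType d)
    (R : realType) (P : probability T R) (G : sgraph) (p : R)
    (chi : G -> {RV P >-> bool}) : Prop :=
  mutually_independent chi /\
  forall v : G, P (chi v @^-1` [set false]) = p%:E /\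
                P (chi v @^-1` [set true]) = (1 - p)%:E.

(* Main.v *)
Require Import Defs.
From HB Require Import structures.
From mathcomp Require Import all_boot all_order all_algebra.
From mathcomp Require Import zify ring lra.

(** Write [x + S] for the vertex [x] with the coordinates in [S] flipped. If
    [lambda] is 2-locally equivalent to [chi], there are a bijection [g] and
    permutations [r_x] of the coordinates with
    [lambda (x + S) = chi (g x + r_x S)] whenever [#|S| <= 2]; if [g] is a cube
    automorphism, then [chi] and [lambda] are equivalent. So it suffices that
    [w_a := g (x + a)] is adjacent to [g x] for all [x] and [a].

    Reading [lambda (x + a + b + c)] through the balls around [x + a] and around
    [x + b] gives [chi (w_a + r_a b + r_a c) = chi (w_b + r_b a + r_b c)]. If
    [w_a + r_a b <> w_b + r_b a] for [t] ordered pairs [(a, b)], these are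
    equations between different vertices that involve about [t ^ 2 / n] vertices,
    while there are only [2 ^ (n ^ 2 * log n)] choices of all the [w_a] and [r_a].
    As [p >= n ^ (- 1 / 4)], a union bound leaves [t] much smaller than
    [p * n ^ 2 / log n]. For the other pairs [w_a] and [w_b] are at distance 2,
    which forces nearly all [w_a] to be neighbours [u + sigma a] of one vertex
    [u], with [r_a b = sigma b] for nearly all pairs. If [u <> g x], or if some
    [w_a] is not adjacent to [u], there remain about [n ^ 2] non-trivial
    equations, now between configurations described by [O(n log n + t log n)]
    bits: a second union bound excludes this. *)

Set Implicit Arguments.
Unset Strict Implicit.
Unset Printing Implicit Defensive.

Import Order.TTheory GRing.Theory Num.Theory.

(** * Coordinate flips *)

Section Cube.
Variable n : nat.
Local Notation V := {ffun 'I_n -> bool}.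
Implicit Types (x y z : V) (a b c d i j : 'I_n).

Definition flip x a : V := [ffun i => x i (+) (i == a)].

Lemma flipC x a b : flip (flip x a) b = flip (flip x b) a.
Proof. by apply/ffunP => i; rewrite !ffunE addbAC. Qed.

Lemma flipK x a : flip (flip x a) a = x.
Proof. by apply/ffunP => i; rewrite !ffunE addbK. Qed.

Lemma flip_injr x : injective (flip x).
Proof.
move=> a b /ffunP/(_ a); rewrite !ffunE eqxx => /(congr1 (addb (x a))).
by rewrite !addKb => /esym/eqP.
Qed.

Lemma neq_coordinate x y : x != y -> exists i, x i != y i.
Proof.
move=> xy; apply/existsP; apply: contraNT xy; rewrite negb_exists => /forallP h.
by apply/eqP/ffunP => i; have /negPn/eqP := h i.
Qed.

Lemma flip2_eqP x a b c d : flip (flip x a) b = flip (flip x c) d ->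
  [\/ a = b /\ c = d, a = c /\ b = d | a = d /\ b = c].
Proof.
have [->|nab] := eqVneq a b.
  rewrite flipK => /(congr1 (flip^~ d)); rewrite flipK => /flip_injr ->.
  by constructor 1.
move=> e; have /ffunP/(_ a) := e.
rewrite !ffunE eqxx (negbTE nab) -!addbA => /addbI.
have [ac|nac] /= := eqVneq a c.
  move: e; rewrite ac => /flip_injr ->.
  by constructor 2.
have [ad|//] := eqVneq a d.
by move: e; rewrite ad (flipC _ c) => /flip_injr ->; constructor 3.
Qed.

(** At a coordinate where [x] and [y] differ, equality of the flipped vertices forces [r c] or [s c]
    to be that coordinate; each happens for at most one [c]. *)
Lemma card_flip_eq x y (B : {set 'I_n}) (r s : 'I_n -> 'I_n) :
  x != y -> {in B &, injective r} -> {in B &, injective s} ->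
  #|[set c in B | flip x (r c) == flip y (s c)]| <= 2.
Proof.
move=> /neq_coordinate[i xyi] rI sI.
apply: (@leq_trans #|[set c in B | r c == i] :|: [set c in B | s c == i]|).
  apply/subset_leq_card/subsetP => c; rewrite !inE => /andP[-> /eqP/ffunP/(_ i)].
  rewrite !ffunE /= ![i == _]eq_sym; move: xyi.
  by case: (x i) (y i) (r c == i) (s c == i) => -[] [] [].
rewrite (leq_trans (leq_card_setU _ _))// (@leq_add _ _ 1 1)//.
- apply/card_le1_eqP => c d; rewrite !inE => /andP[cB /eqP <-] /andP[dB /eqP].
  by move=> /rI ->.
- apply/card_le1_eqP => c d; rewrite !inE => /andP[cB /eqP <-] /andP[dB /eqP].
  by move=> /sI ->.
Qed.

(* The pairs with [r b < r c], and those with [r c < r b], are each mapped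
   injectively; at most [n] pairs are left. *)
Lemma card_flip2_image z (r : 'I_n -> 'I_n) (S : {set 'I_n * 'I_n})
    (J : {set V}) : injective r ->
  (forall b c, (b, c) \in S -> flip (flip z (r b)) (r c) \in J) ->
  #|S| <= 2 * #|J| + n.
Proof.
move=> rI SJ.
pose f (bc : 'I_n * 'I_n) := flip (flip z (r bc.1)) (r bc.2).
pose S1 := [set bc in S | r bc.1 < r bc.2].
pose S2 := [set bc in S | r bc.2 < r bc.1].
pose S3 := [set bc : 'I_n * 'I_n | bc.1 == bc.2].
have half (e : rel 'I_n) : (forall b c, e b c -> ~~ e c b) ->
    #|[set bc in S | e (r bc.1) (r bc.2)]| <= #|J|.
  move=> eA; rewrite -(@card_in_imset _ _ f); last first.
    move=> [b c] [b' c']; rewrite !inE /= => /andP[_ h] /andP[_ h'].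
    case/flip2_eqP => -[/= e1 e2].
        by rewrite e1 in h; have := eA _ _ h; rewrite h.
      by move/rI: e1 => /= ->; move/rI: e2 => /= ->.
    by have := eA _ _ h; rewrite e1 e2 h'.
  apply/subset_leq_card/subsetP => _ /imsetP[[b c] + ->].
  by rewrite inE => /andP[bcS _]; exact: SJ.
have l1 : #|S1| <= #|J|.
  by apply: (half (fun b c => b < c)) => b c; rewrite -leqNgt => /ltnW.
have l2 : #|S2| <= #|J|.
  by apply: (half (fun b c => c < b)) => b c; rewrite -leqNgt => /ltnW.
have l3 : #|S3| <= n.
  rewrite -[leqRHS]card_ord -(@card_in_imset _ _ fst S3).
    exact: max_card.
  by move=> [b c] [b' c']; rewrite !inE /= => /eqP -> /eqP -> /= ->.
apply: (@leq_trans #|S1 :|: S2 :|: S3|).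
  apply/subset_leq_card/subsetP => -[b c] bcS; rewrite !inE bcS /=.
  by rewrite -(inj_eq rI) -val_eqE; case: ltngtP.
rewrite (leq_trans (leq_card_setU _ _))// leq_add// mul2n -addnn.
by rewrite (leq_trans (leq_card_setU _ _))// leq_add.
Qed.

Definition sphere2 x : {set V} :=
  [set flip (flip x ab.1) ab.2 | ab in [set ab : 'I_n * 'I_n | ab.1 != ab.2]].

(** At a coordinate where [x] and [y] differ, a common vertex differs from one of them, so this
    coordinate is one of its two flips; the other has [n] values. *)
Lemma card_sphere2I x y : x != y -> #|sphere2 x :&: sphere2 y| <= 2 * n.
Proof.
move=> /neq_coordinate[i xyi].
pose F u := [set flip (flip u i) j | j : 'I_n].
apply: (@leq_trans #|F x :|: F y|).
  apply/subset_leq_card/subsetP => z; rewrite !inE => /andP[].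
  move=> /imsetP[[a b] _ /= za] /imsetP[[c d] _ /= zc].
  have /ffunP/(_ i) := esym za; rewrite {1}zc !ffunE.
  have [ia|ia] := eqVneq i a.
    by move=> _; apply/orP; left; rewrite za -ia; apply/imsetP; exists b.
  have [ib|ib] := eqVneq i b.
    by move=> _; apply/orP; left; rewrite za flipC -ib; apply/imsetP; exists a.
  have [ic|ic] := eqVneq i c.
    by move=> _; apply/orP; right; rewrite zc -ic; apply/imsetP; exists d.
  have [id|id] := eqVneq i d.
    by move=> _; apply/orP; right; rewrite zc flipC -id; apply/imsetP; exists c.
  by rewrite !addbF => e; rewrite e eqxx in xyi.
rewrite (leq_trans (leq_card_setU _ _))// mul2n -addnn leq_add//.
- by rewrite (leq_trans (leq_imset_card _ _))// cardT size_enum_ord.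
- by rewrite (leq_trans (leq_imset_card _ _))// cardT size_enum_ord.
Qed.

(** That is, the distance is 0 or 2. *)
Definition near2 x y := exists i j, flip x i = flip y j.

(** Both [x2] and [x3] are two flips away from [x1]. A shared flip leads to the centre; four
    distinct flips would put them at distance 4. *)
Lemma near2_center x1 x2 x3 : x1 <> x2 -> x1 <> x3 -> x2 <> x3 ->
  near2 x1 x2 -> near2 x1 x3 -> near2 x2 x3 ->
  exists v s1 s2 s3, [/\ x1 = flip v s1, x2 = flip v s2 & x3 = flip v s3].
Proof.
move=> n12 n13 n23 [i [j e2]] [k [l e3]] [m [m' e]].
have E2 : x2 = flip (flip x1 i) j by rewrite e2 flipK.
have E3 : x3 = flip (flip x1 k) l by rewrite e3 flipK.
have ij : i <> j by move=> ij; apply: n12; rewrite E2 ij flipK.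
have kl : k <> l by move=> kl; apply: n13; rewrite E3 kl flipK.
have [ik|ik] := eqVneq i k.
  by exists (flip x1 i), i, j, l; split; rewrite ?flipK // E3 ik.
have [il|il] := eqVneq i l.
  by exists (flip x1 i), i, j, k; split; rewrite ?flipK // E3 il flipC.
have [jk|jk] := eqVneq j k.
  by exists (flip x1 j), j, i, l; split; rewrite ?flipK // ?E2 ?E3 ?jk // flipC.
have [jl|jl] := eqVneq j l.
  by exists (flip x1 j), j, i, k; split; rewrite ?flipK // ?E2 ?E3 ?jl // flipC.
move/eqP: ij => ij; move/eqP: kl => kl.
(* One flip on each side makes [x2] and [x3] equal, but the three coordinates [i], [j], [k] already
   need three flips. *)
have h t : flip (flip (flip x1 i) j) m t = flip (flip (flip x1 k) l) m' t.
  by rewrite -E2 -E3 e.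
move: (h i) (h j) (h k) (h l); rewrite !ffunE !eqxx.
rewrite (eq_sym j i) (eq_sym k i) (eq_sym k j).
rewrite (eq_sym l i) (eq_sym l j) (eq_sym l k).
rewrite (negbTE ij) (negbTE kl) (negbTE ik) (negbTE il) (negbTE jk) (negbTE jl).
have uniq2 (t t' u : 'I_n) : t != t' -> (t == u) && (t' == u) = false.
  by move=> tt'; apply/negP => /andP[/eqP tu /eqP tu']; rewrite tu tu' eqxx in tt'.
have := uniq2 _ _ m ij; have := uniq2 _ _ m ik; have := uniq2 _ _ m jk.
have := uniq2 _ _ m' ij; have := uniq2 _ _ m' ik; have := uniq2 _ _ m' jk.
case: (i == m) (j == m) (k == m) (i == m') (j == m') (k == m');
  move=> [] [] [] [] [] //=; by case: (x1 i) (x1 j) (x1 k) => -[] [].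
Qed.

(** If [x] is near [v + s1] but not adjacent to [v], it is [v + s1] with two further flips; being
    near [v + s2] and [v + s3] makes these [s2] and [s3]. *)
Lemma near2_star v s1 s2 s3 x : s1 <> s2 -> s1 <> s3 -> s2 <> s3 ->
  near2 x (flip v s1) -> near2 x (flip v s2) -> near2 x (flip v s3) ->
  (exists s, x = flip v s) \/ x = flip (flip (flip v s1) s2) s3.
Proof.
have aux s : near2 x (flip v s) ->
    (exists s', x = flip v s') \/ exists i j,
      [/\ s != i, s != j, i != j & x = flip (flip (flip v s) i) j].
  move=> [i [j e]].
  have E : x = flip (flip (flip v s) j) i by rewrite -e flipK.
  have [si|si] := eqVneq s i; first by left; exists j; rewrite E -si flipC flipK.
  have [sj|sj] := eqVneq s j; first by left; exists i; rewrite E -sj flipK.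
  have [ij|ij] := eqVneq i j; first by left; exists s; rewrite E -ij flipK.
  by right; exists i, j; split => //; rewrite E flipC.
move=> n12 n13 n23 /aux[|[i [j [si sj ij E]]]]; first by left.
have mem s : s <> s1 -> near2 x (flip v s) ->
    (exists s', x = flip v s') \/ s = i \/ s = j.
  move=> /eqP ss1 /aux[|[i' [j' [si' sj' ij' E']]]]; first by left.
  right; move: (E); rewrite E' => /ffunP/(_ s); rewrite !ffunE eqxx.
  rewrite (negbTE si') (negbTE sj') (negbTE ss1).
  case: (eqVneq s i); first by left.
  case: (eqVneq s j); first by right.
  by case: (v s).
move=> /(mem _ (nesym n12))[|h2]; first by left.
move=> /(mem _ (nesym n13))[|h3]; first by left.
right; rewrite E; case: h2 h3 n23 => -> [] -> // _.
by rewrite flipC.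
Qed.

End Cube.

(** * Counting in finite sets *)

Lemma card_pairs n (S : {set 'I_n * 'I_n}) :
  #|S| = \sum_(i < n) #|[set j : 'I_n | (i, j) \in S]|.
Proof.
rewrite -sum1_card big_mkcond /=.
under [RHS]eq_bigr do rewrite -sum1_card big_mkcond /=.
rewrite pair_bigA /=; apply: eq_bigr => -[i j] _ /=.
by rewrite inE.
Qed.

Lemma card_setU_le (T : finType) (A B : {set T}) : #|A :|: B| <= #|A| + #|B|.
Proof. by case: (leq_card_setU A B). Qed.

Lemma exists_notin_card (I : finType) (S : {set I}) :
  #|S| < #|I| -> exists i, i \notin S.
Proof.
move=> h; have : 0 < #|~: S| by rewrite cardsCs setCK subn_gt0.
by case/card_gt0P => i; rewrite inE; exists i.
Qed.

(** Only [m] of the sets are used, added one at a time: each loses at most [D] to each earlier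
    one. *)
Lemma card_bigcup_ge (I T : finType) (A : {set I}) (F : I -> {set T}) K D m :
  (forall a, a \in A -> K <= #|F a|) ->
  {in A &, forall a b, a != b -> #|F a :&: F b| <= D} ->
  m <= #|A| -> m * K <= #|\bigcup_(a in A) F a| + m * m * D.
Proof.
move=> FK FD mA.
suff [S [SA Sm SK]] : exists S : {set I}, [/\ S \subset A, #|S| = m &
    m * K <= #|\bigcup_(a in S) F a| + m * m * D].
  apply: (leq_trans SK); rewrite leq_add2r.
  by apply/subset_leq_card/bigcupsP => a aS; rewrite bigcup_sup// (subsetP SA).
elim: m mA => [|m IH] mA; first by exists set0; rewrite sub0set cards0.
have [S [SA Sm SK]] := IH (ltnW mA).
have [a aAS] : exists a, a \in A :\: S.
  by apply/set0Pn; rewrite -card_gt0 cardsDS// Sm subn_gt0.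
move: aAS; rewrite inE => /andP[aS aA].
exists (a |: S); split.
- by rewrite subUset sub1set aA.
- by rewrite cardsU1 aS Sm.
rewrite bigcup_setU big_set1 cardsU.
have Fa := FK a aA.
have UD : #|F a :&: \bigcup_(b in S) F b| <= m * D.
  rewrite big_distrr /= -Sm -sum_nat_const.
  apply: leq_trans (_ : _ <= \sum_(b in S) #|F a :&: F b|) _.
    elim/big_rec2: _ => [|b x y _ h]; first by rewrite cards0.
    by rewrite (leq_trans (card_setU_le _ _))// leq_add2l.
  apply: leq_sum => b bS; apply: FD => //; first by rewrite (subsetP SA).
  by apply: contraNneq aS => ->.
have := subset_leq_card (subsetIl (F a) (\bigcup_(b in S) F b)).
nia.
Qed.

(** * Equations between colours, and local rigidity *)

Section Respects.
Variable T : finType.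

Definition respects (E : rel T) (chi : T -> bool) :=
  forall z z', E z z' -> chi z = chi z'.

(** The size of this set measures how restrictive the system is; it governs the exponent in
    [sum_cweight_respects]. *)
Definition moved (E : rel T) : {set T} :=
  [set z | [exists z', E z z' && (z' != z)]].

End Respects.

Section Core.
Variable n : nat.
Local Notation V := {ffun 'I_n -> bool}.
Implicit Types (x y z : V) (a b c d i j : 'I_n).

(* [z] and [z'] are the positions of [x + a + b + c] read through the balls
   around [x + a] and [x + b], which are centred at [w a] and [w b]. *)
Definition star_rel (w : 'I_n -> V) (pi : 'I_n -> 'I_n -> 'I_n) : rel V :=
  fun z z' => [exists a, exists b, exists c,
    [&& a != b, a != c, b != c, z == flip (flip (w a) (pi a b)) (pi a c)
      & z' == flip (flip (w b) (pi b a)) (pi b c)]].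

Lemma star_relP w pi a b c : a != b -> a != c -> b != c ->
  star_rel w pi (flip (flip (w a) (pi a b)) (pi a c))
                (flip (flip (w b) (pi b a)) (pi b c)).
Proof.
move=> ab ac bc; apply/existsP; exists a; apply/existsP; exists b.
by apply/existsP; exists c; rewrite ab ac bc !eqxx.
Qed.

(** The pairs for which the balls around [x + a] and [x + b] disagree on the position of
    [x + a + b]. *)
Definition bad_pairs (w : 'I_n -> V) (pi : 'I_n -> 'I_n -> 'I_n) :=
  [set ab : 'I_n * 'I_n |
    flip (w ab.1) (pi ab.1 ab.2) != flip (w ab.2) (pi ab.2 ab.1)].

Definition bad_at w pi a := [set b | (a, b) \in bad_pairs w pi].

(** At least [m] directions [a] have [10 * m] bad partners. Each provides [4 * n * m] moved vertices
    at distance 2 from [w a], and two such spheres share at most [2 * n] vertices. *)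
Lemma card_moved_star w pi m : injective w -> (forall a, injective (pi a)) ->
  40 <= n -> 0 < m -> 20 * n * m < #|bad_pairs w pi| ->
  2 * n * m ^ 2 <= #|moved (star_rel w pi)|.
Proof.
move=> wI piI n40 m0 bad.
pose A := [set a | 10 * m <= #|bad_at w pi a|].
have mA : m <= #|A|.
  move: bad; rewrite card_pairs (bigID (mem A)) /= => bad.
  have h1 : \sum_(a in A) #|bad_at w pi a| <= #|A| * n.
    rewrite -sum_nat_const; apply: leq_sum => a _.
    by rewrite -[leqRHS]card_ord max_card.
  have h2 : \sum_(a | a \notin A) #|bad_at w pi a| <= n * (10 * m).
    apply: leq_trans (_ : _ <= \sum_(a | a \notin A) 10 * m) _.
      by apply: leq_sum => a; rewrite inE -ltnNge => /ltnW.
    by rewrite sum_nat_const leq_mul2r -[X in _ <= X]card_ord max_card orbT.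
  rewrite leqNgt; apply/negP => Am.
  have := leq_trans bad (leq_add h1 h2).
  have : #|A| * n <= m * n by rewrite leq_mul// ltnW.
  nia.
pose F a := moved (star_rel w pi) :&: sphere2 (w a).
have FK a : a \in A -> 4 * n * m <= #|F a|.
  rewrite inE => am.
  pose R := [set bc : 'I_n * 'I_n | [&& bc.1 \in bad_at w pi a, a != bc.2,
    bc.1 != bc.2 & flip (flip (w a) (pi a bc.1)) (pi a bc.2)
                   != flip (flip (w bc.1) (pi bc.1 a)) (pi bc.1 bc.2)]].
  have RF : #|R| <= 2 * #|F a| + n.
    apply: (@card_flip2_image _ (w a) (pi a)) => // b c.
    rewrite inE /= => /and4P[bad_b ac bc ne].
    have ab : a != b.
      by apply: contraTneq bad_b => ->; rewrite !inE eqxx.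
    rewrite inE; apply/andP; split.
      rewrite inE; apply/existsP; exists (flip (flip (w b) (pi b a)) (pi b c)).
      by rewrite star_relP//= eq_sym.
    by apply/imsetP; exists (pi a b, pi a c); rewrite ?inE //= (inj_eq (piI a)).
  (* For a bad [b] at most four [c] are lost: [a], [b], and two for which the positions coincide. *)
  have Rge : #|bad_at w pi a| * (n - 4) <= #|R|.
    suff Rb_ge (b : 'I_n) : b \in bad_at w pi a ->
        n - 4 <= #|[set c : 'I_n | (b, c) \in R]|.
      rewrite card_pairs (bigID (mem (bad_at w pi a))) /= -sum_nat_const.
      by rewrite (leq_trans _ (leq_addr _ _))//; apply: leq_sum.
    move=> bad_b; set Rb := [set c : 'I_n | _].
    pose S := [set c in [set: 'I_n] | flip (flip (w a) (pi a b)) (pi a c)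
                                      == flip (flip (w b) (pi b a)) (pi b c)].
    have : [set: 'I_n] \subset Rb :|: ([set a; b] :|: S).
      apply/subsetP => c _; rewrite !inE /=.
      move: bad_b; rewrite !inE /= => -> /=.
      by rewrite (eq_sym c a) (eq_sym c b); case: eqP; case: eqP; case: eqP.
    move/subset_leq_card; rewrite cardsT card_ord => h.
    rewrite leq_subLR addnC; apply: (leq_trans h).
    rewrite (leq_trans (card_setU_le _ _))// leq_add2l.
    rewrite (leq_trans (card_setU_le _ _))// (@leq_add _ _ 2 2)//.
      by rewrite cards2; case: eqP.
    apply: card_flip_eq; last 2 first.
    - by move=> ? ? _ _; exact: piI.
    - by move=> ? ? _ _; exact: piI.
    by move: bad_b; rewrite !inE.
  nia.
have FD : {in A &, forall a b, a != b -> #|F a :&: F b| <= 2 * n}.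
  move=> a b _ _ ab; apply: leq_trans (card_sphere2I (x := w a) (y := w b) _).
    by apply/subset_leq_card/setISS; exact: subsetIr.
  by rewrite (inj_eq wI).
have := card_bigcup_ge FK FD mA.
have : #|\bigcup_(a in A) F a| <= #|moved (star_rel w pi)|.
  by apply/subset_leq_card/bigcupsP => a _; exact: subsetIl.
nia.
Qed.

Definition oflip x (o : option 'I_n) := if o is Some a then flip x a else x.

(* [z'] is the presumed centre [u] of the star and [sigma b] the direction of
   [w b] for [b] in [B]; [X] lists the pairs [(b, c)] on which the reading of
   [x + b + c] is not the expected [u + sigma b + sigma c]. With [tau b = None]
   and [z = g x] the relation compares this reading with that of the ball around
   [x]; with [tau b = Some (r_b a)] and [z = w a] it compares the readings of
   [x + a + b + c] through the balls around [x + b] and [x + a]. *)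
Definition frame_rel z z' (rho sigma : 'I_n -> 'I_n) (tau : 'I_n -> option 'I_n)
    (B : {set 'I_n}) (X : {set 'I_n * 'I_n}) : rel V :=
  fun y y' => [exists b, exists c,
    [&& b \in B, c \in B, (b, c) \notin X, y == flip (flip z (rho b)) (rho c)
      & y' == flip (oflip (flip z' (sigma b)) (tau b)) (sigma c)]].

(** Of the pairs in [B], at least [81 / 100] of [n ^ 2], at most [s] lie in [X]. Trivial equations
    take at most [n] pairs for each of 3 exceptional [b], and two for any other [b]. Off the
    diagonal, at most two of the remaining pairs give the same vertex. *)
Lemma card_moved_frame z z' (rho sigma : 'I_n -> 'I_n)
    (tau : 'I_n -> option 'I_n) (B : {set 'I_n}) (X : {set 'I_n * 'I_n}) s :
  injective rho ->
  {in B &, injective sigma} ->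
  #|[set b in B | flip z (rho b) == oflip (flip z' (sigma b)) (tau b)]| <= 3 ->
  9 * n <= 10 * #|B| -> #|X| <= s -> 10 * s + 80 * n <= 3 * n ^ 2 ->
  n ^ 2 <= 4 * #|moved (frame_rel z z' rho sigma tau B X)|.
Proof.
move=> rhoI sI; set AL := [set b in B | _] => AL3 B9 Xs sn.
pose y' b c := flip (oflip (flip z' (sigma b)) (tau b)) (sigma c).
pose R := [set bc : 'I_n * 'I_n | [&& bc.1 \in B, bc.2 \in B, bc \notin X &
  flip (flip z (rho bc.1)) (rho bc.2) != y' bc.1 bc.2]].
have RJ : #|R| <= 2 * #|moved (frame_rel z z' rho sigma tau B X)| + n.
  apply: (@card_flip2_image _ z rho) => // b c.
  rewrite inE /= => /and4P[bB cB X' ne].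
  rewrite inE; apply/existsP; exists (y' b c); rewrite eq_sym ne andbT.
  by apply/existsP; exists b; apply/existsP; exists c; rewrite bB cB X' !eqxx.
pose R' := [set bc : 'I_n * 'I_n | [&& bc.1 \in B, bc.1 \notin AL, bc.2 \in B &
  flip (flip z (rho bc.1)) (rho bc.2) == y' bc.1 bc.2]].
have R'n : #|R'| <= n * 2.
  rewrite card_pairs -[X in _ <= X * 2]card_ord -sum_nat_const.
  apply: leq_sum => b _.
  have [bA|bA] := boolP ((b \in B) && (b \notin AL)); last first.
    rewrite eq_card0// => c; rewrite !inE /=; move: bA; rewrite !inE.
    by case: (b \in B) => //= /negbNE ->.
  apply: leq_trans (_ : _ <= #|[set c in B | flip (flip z (rho b)) (rho c)
     == flip (oflip (flip z' (sigma b)) (tau b)) (sigma c)]|) _.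
    by apply/subset_leq_card/subsetP => c; rewrite !inE /= => /and4P[_ _ -> ->].
  apply: card_flip_eq => //; last by move=> ? ? _ _; exact: rhoI.
  by move: bA; rewrite inE => /andP[-> /=].
have Aln : #|setX AL [set: 'I_n]| <= 3 * n.
  by rewrite cardsX cardsT card_ord leq_mul2r AL3 orbT.
have : setX B B \subset (R :|: X) :|: (R' :|: setX AL [set: 'I_n]).
  apply/subsetP => -[b c]; rewrite in_setX => /andP[bB cB].
  rewrite !in_setU in_setX in_setT andbT [_ \in R]inE [_ \in R']inE /= bB cB /=.
  case: (_ \in X); rewrite ?orbT //= orbF.
  by case: (b \in AL); rewrite ?orbT//= orbF orNb.
move/subset_leq_card; rewrite cardsX => h.
have hU : #|B| * #|B| <= #|R| + s + (n * 2 + 3 * n).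
  apply: (leq_trans h); rewrite (leq_trans (card_setU_le _ _))// leq_add//.
    by rewrite (leq_trans (card_setU_le _ _))// leq_add2l.
  by rewrite (leq_trans (card_setU_le _ _))// leq_add.
nia.
Qed.

Variables (chi : V -> bool) (m : nat).
(** The two thresholds are the lower bounds of [card_moved_star] and [card_moved_frame], which turns
    many non-trivial equations into a contradiction. *)
Hypothesis star_rigid : forall (w : 'I_n -> V) (pi : 'I_n -> 'I_n -> 'I_n),
  respects (star_rel w pi) chi -> #|moved (star_rel w pi)| < 2 * n * m ^ 2.
Hypothesis frame_rigid : forall z z' (rho sigma : 'I_n -> 'I_n)
    (tau : 'I_n -> option 'I_n) (B : {set 'I_n}) (X : {set 'I_n * 'I_n}),
  #|X| <= 20 * n * m + 2 * n ->
  respects (frame_rel z z' rho sigma tau B X) chi ->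
  4 * #|moved (frame_rel z z' rho sigma tau B X)| < n ^ 2.
Hypotheses (m_gt0 : 0 < m) (nm : 2000 * (100 * m) <= n).

Variables (w : 'I_n -> V) (pi : 'I_n -> 'I_n -> 'I_n).
Variables (v : V) (pv : 'I_n -> 'I_n).
Hypotheses (wI : injective w) (piI : forall a, injective (pi a))
  (pvI : injective pv).
Hypothesis chi_w : forall a b c, a != b -> a != c -> b != c ->
  chi (flip (flip (w a) (pi a b)) (pi a c)) =
  chi (flip (flip (w b) (pi b a)) (pi b c)).
Hypothesis chi_v : forall a b, a != b ->
  chi (flip (flip v (pv a)) (pv b)) = chi (flip (w a) (pi a b)).

Let few_bad : #|bad_pairs w pi| <= 20 * n * m.
Proof.
rewrite leqNgt; apply/negP => bad.
have n40 : 40 <= n by lia.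
have := card_moved_star wI piI n40 m_gt0 bad.
rewrite leqNgt star_rigid// => z z' /existsP[a /existsP[b /existsP[c]]].
by case/and5P=> ab ac bc /eqP -> /eqP ->; exact: chi_w.
Qed.

Let good_near2 a b : b \notin bad_at w pi a -> near2 (w a) (w b).
Proof. by rewrite !inE /= negbK => /eqP; exists (pi a b), (pi b a). Qed.

Definition star_set x := [set b | [exists s, w b == flip x s]].

Definition star_dir x b := odflt b [pick s | w b == flip x s].

Let star_dirP x b : b \in star_set x -> w b = flip x (star_dir x b).
Proof.
rewrite inE => /existsP[s hs]; rewrite /star_dir.
by case: pickP => [t /eqP//|/(_ s)]; rewrite hs.
Qed.

Let star_dir_inj x : {in star_set x &, injective (star_dir x)}.
Proof.
by move=> b c bS cS e; apply: wI; rewrite (star_dirP bS) (star_dirP cS) e.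
Qed.

(** Three directions with few bad partners, pairwise good, give vertices at pairwise distance 2,
    hence three neighbours of one [x]. If [a] is good for all three, [w a] is adjacent to [x], up to
    the single exception in [near2_star]. *)
Let large_star : exists x, 9 * n <= 10 * #|star_set x|.
Proof.
pose H := [set a | n < 100 * #|bad_at w pi a|].
(* By [few_bad], [H] has at most [2000 * m] elements, which [nm] bounds by [n / 100]. *)
have Hn : 100 * #|H| <= n.
  have : \sum_(a in H) n <= 100 * (20 * n * m).
    apply: leq_trans (leq_mul (leqnn 100) few_bad).
    rewrite card_pairs big_distrr /= [leqRHS](bigID (mem H)) /=.
    rewrite (leq_trans _ (leq_addr _ _))//; apply: leq_sum => a.
    by rewrite inE => /ltnW.
  rewrite sum_nat_const; nia.
have low a : a \notin H -> 100 * #|bad_at w pi a| <= n by rewrite inE -leqNgt.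
have [t1 t1H] : exists a, a \notin H.
  by apply: exists_notin_card; rewrite card_ord; lia.
have l1 := low _ t1H.
have [t2] : exists a, a \notin (t1 |: H) :|: bad_at w pi t1.
  apply: exists_notin_card; rewrite card_ord.
  apply: leq_ltn_trans (card_setU_le _ _) _.
  have : #|t1 |: H| <= 1 + #|H| by rewrite cardsU1 leq_add2r; case: (_ \notin _).
  lia.
rewrite in_setU in_setU1 !negb_or => /andP[/andP[t21 t2H] t12].
have l2 := low _ t2H.
have [t3] : exists a,
    a \notin ([set t1; t2] :|: H) :|: (bad_at w pi t1 :|: bad_at w pi t2).
  apply: exists_notin_card; rewrite card_ord.
  apply: leq_ltn_trans (card_setU_le _ _) _.
  have := card_setU_le [set t1; t2] H.
  have := card_setU_le (bad_at w pi t1) (bad_at w pi t2).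
  have : #|[set t1; t2]| <= 2 by rewrite cards2; case: eqP.
  lia.
rewrite !in_setU !in_set1 !negb_or.
move=> /andP[/andP[/andP[t31 t32] t3H] /andP[t13 t23]].
have l3 := low _ t3H.
have [x [s1 [s2 [s3 [e1 e2 e3]]]]] :
    exists x s1 s2 s3, [/\ w t1 = flip x s1, w t2 = flip x s2 & w t3 = flip x s3].
  by apply: near2_center; do ?[exact: good_near2];
     apply/eqP; rewrite (inj_eq wI) eq_sym.
exists x.
have : ~: star_set x \subset (bad_at w pi t1 :|: bad_at w pi t2) :|:
    (bad_at w pi t3 :|: [set a | w a == flip (flip (flip x s1) s2) s3]).
  apply/subsetP => a; rewrite in_setC; apply: contraR.
  rewrite !in_setU !negb_or => /andP[/andP[g1 g2] /andP[g3 na]].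
  have near2C y y' : near2 y y' -> near2 y' y by move=> [i [j e]]; exists j, i.
  rewrite inE; apply/existsP.
  have [||||||[s ->]|E] := @near2_star _ x s1 s2 s3 (w a).
  - by move=> s12; move/eqP: t21; apply; apply: wI; rewrite e1 e2 s12.
  - by move=> s13; move/eqP: t31; apply; apply: wI; rewrite e1 e3 s13.
  - by move=> s23; move/eqP: t32; apply; apply: wI; rewrite e2 e3 s23.
  - by rewrite -e1; exact/near2C/good_near2.
  - by rewrite -e2; exact/near2C/good_near2.
  - by rewrite -e3; exact/near2C/good_near2.
  - by exists s.
  - by rewrite inE E eqxx in na.
move/subset_leq_card => h; have := leq_trans h (card_setU_le _ _).
have := card_setU_le (bad_at w pi t1) (bad_at w pi t2).
have := card_setU_le (bad_at w pi t3)
  [set a | w a == flip (flip (flip x s1) s2) s3].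
have : #|[set a | w a == flip (flip (flip x s1) s2) s3]| <= 1.
  apply/card_le1_eqP => a b; rewrite !inE => /eqP <- /eqP; exact: wI.
have := cardsC (star_set x); rewrite card_ord.
lia.
Qed.

(** * The centre [x] of the star, and its comparison with [v] *)

Section Center.
Variable x : V.
Hypothesis large : 9 * n <= 10 * #|star_set x|.

Let B := star_set x.
Let sg := star_dir x.
Let X := [set bc in setX B B | (bc.1 == bc.2) || (pi bc.1 bc.2 != sg bc.2)].

(** Off the bad pairs [x + sg b + pi b c = x + sg c + pi c b]. For [b <> c] this makes [pi b c]
    equal to [sg c] or to [sg b], the latter for at most one [c] per [b]. *)
Let card_X : #|X| <= 20 * n * m + 2 * n.
Proof.
pose D := [set bc : 'I_n * 'I_n | bc.2 == bc.1].
pose D' := [set bc : 'I_n * 'I_n | pi bc.1 bc.2 == sg bc.1].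
have Dn : #|D| <= n * 1.
  rewrite card_pairs -[X in _ <= X * 1]card_ord -sum_nat_const.
  apply: leq_sum => b _; apply/card_le1_eqP => c c'.
  by rewrite !inE /= => /eqP -> /eqP ->.
have D'n : #|D'| <= n * 1.
  rewrite card_pairs -[X in _ <= X * 1]card_ord -sum_nat_const.
  apply: leq_sum => b _; apply/card_le1_eqP => c c'.
  by rewrite !inE /= => /eqP <- /eqP /piI ->.
have : X \subset bad_pairs w pi :|: (D :|: D').
  apply/subsetP => -[b c]; rewrite inE in_setX /= => /andP[/andP[bB cB] bc].
  rewrite 2!in_setU [(b, c) \in D]inE [(b, c) \in D']inE /= (eq_sym c).
  have [//|] := boolP (_ \in bad_pairs w pi); move: bc.
  case: eqVneq => //= cb bc; rewrite inE /= negbK => bad_bc.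
  move: bad_bc bc; rewrite (star_dirP bB) (star_dirP cB) => /eqP.
  case/flip2_eqP => -[]; rewrite /sg.
  - by move=> <-; rewrite eqxx.
  - by move=> /star_dir_inj e; rewrite e// eqxx in cb.
  - by move=> _ ->; rewrite eqxx.
move/subset_leq_card => h; have := leq_trans h (card_setU_le _ _).
have := card_setU_le D D'; move: few_bad; lia.
Qed.

Let not_X b c : b \in B -> c \in B -> (b, c) \notin X ->
  b != c /\ pi b c = sg c.
Proof.
by move=> bB cB; rewrite inE in_setX bB cB /= negb_or negbK => /andP[-> /eqP].
Qed.

Let arith : 10 * (20 * n * m + 2 * n) + 80 * n <= 3 * n ^ 2.
Proof. nia. Qed.

(** If [v <> x], the equations [chi_v] form a frame with too many moved vertices, since at most two
    [b] satisfy [v + pv b = x + sg b]. *)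
Let center_eq : v = x.
Proof.
apply/eqP; apply/negPn/negP => vx.
have : 4 * #|moved (frame_rel v x pv sg (fun=> None) B X)| < n ^ 2.
  apply: frame_rigid; first exact: card_X.
  move=> z z' /existsP[b /existsP[c /and5P[bB cB bcX /eqP -> /eqP ->]]] /=.
  have [bc e] := not_X bB cB bcX.
  by rewrite chi_v// e (star_dirP bB).
apply/negP; rewrite -leqNgt.
apply: card_moved_frame pvI (@star_dir_inj x) _ large card_X arith.
rewrite (leq_trans (card_flip_eq vx _ (@star_dir_inj x)))// => b c _ _.
exact: pvI.
Qed.

(** If [w a] is not adjacent to [x], comparing its ball with those around the [w b] for [b] in [B]
    gives a frame with too many moved vertices, as at most three [b] are exceptional. *)
Let star_full a : a \in B.
Proof.
apply/negPn/negP => aB.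
have : 4 * #|moved (frame_rel (w a) x (pi a) sg (fun b => Some (pi b a)) B X)|
    < n ^ 2.
  apply: frame_rigid; first exact: card_X.
  move=> z z' /existsP[b /existsP[c /and5P[bB cB bcX /eqP -> /eqP ->]]] /=.
  have [bc e] := not_X bB cB bcX.
  by rewrite chi_w// ?e ?(star_dirP bB)//; apply: contraNneq aB => ->.
apply/negP; rewrite -leqNgt.
apply: card_moved_frame (@piI a) (@star_dir_inj x) _ large card_X arith.
set AL := [set b in B | _].
(* Four exceptional [b] would put [w a] near four neighbours of [x]; by [near2_star] it would then
   be reached from [x] by two different triples of flips. *)
rewrite leqNgt; apply/negP => AL4.
have AL_near b : b \in AL -> near2 (w a) (flip x (sg b)).
  rewrite inE => /andP[bB /eqP e]; exists (pi a b), (pi b a).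
  by rewrite e /=.
have AL_neq b c : b \in AL -> c \in AL -> b != c -> sg b <> sg c.
  rewrite !inE => /andP[bB _] /andP[cB _] /eqP bc e.
  by apply: bc; apply: star_dir_inj e; rewrite ?inE.
have := enum_uniq (mem AL); have := mem_enum (mem AL); move: AL4; rewrite cardE.
case: (enum AL) => [|b1 [|b2 [|b3 [|b4 l]]]]//= _ memAL.
rewrite !inE !negb_or -!andbA => /and5P[n12 n13 n14 _ /and5P[n23 n24 _ n34 _]].
have A1 : b1 \in AL by rewrite -[_ \in AL]memAL !inE eqxx ?orbT.
have A2 : b2 \in AL by rewrite -[_ \in AL]memAL !inE eqxx ?orbT.
have A3 : b3 \in AL by rewrite -[_ \in AL]memAL !inE eqxx ?orbT.
have A4 : b4 \in AL by rewrite -[_ \in AL]memAL !inE eqxx ?orbT.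
have star b c d : b \in AL -> c \in AL -> d \in AL ->
    b != c -> b != d -> c != d ->
    w a = flip (flip (flip x (sg b)) (sg c)) (sg d).
  move=> bA cA dA bc bd cd.
  have [||||||[s e]|//] := @near2_star _ x (sg b) (sg c) (sg d) (w a);
    do ?[exact: AL_near | exact: AL_neq].
  by case/negP: aB; rewrite inE; apply/existsP; exists s; rewrite e.
have := star _ _ _ A1 A2 A3 n12 n13 n23; rewrite (star _ _ _ A1 A2 A4) //.
by move/flip_injr/(AL_neq _ _ A4 A3); apply; rewrite eq_sym.
Qed.

Lemma star_center a : exists i, w a = flip v i.
Proof.
by have := star_full a; rewrite center_eq inE => /existsP[i /eqP]; exists i.
Qed.

End Center.

Lemma local_star a : exists i, w a = flip v i.
Proof. by have [x hx] := large_star; exact: star_center hx a. Qed.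

End Core.

(** * Choice of the parameters *)

Lemma poly_le_pow2 d C : exists N, forall l, N <= l -> C * l ^ d <= 2 ^ l.
Proof.
elim: d C => [|d IH] C.
  exists C => l Cl; rewrite expn0 muln1 (leq_trans Cl)// ltnW// ltn_expl//.
(* With [h] half of [l], one factor [2 ^ h] absorbs a factor [h] and the other absorbs the rest by
   induction; [3] comes from [l <= 3 * h]. *)
have [N hN] := IH (C * 3 ^ d.+1).
exists (2 * N).+2 => l Nl.
pose h := l./2.
have Nh : N <= h by rewrite /h; lia.
have lh : l <= 3 * h by rewrite /h; lia.
have hl : h + h <= l by rewrite /h; lia.
apply: leq_trans (_ : _ <= C * (3 * h) ^ d.+1) _.
  by rewrite leq_mul2l leq_exp2r// lh orbT.
apply: leq_trans (_ : _ <= 2 ^ (h + h)) _; last by rewrite leq_exp2l.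
rewrite expnMn [h ^ _]expnSr !mulnA expnD leq_mul ?hN//.
by rewrite ltnW// ltn_expl.
Qed.

(* [k] is about [n ^ (1 / 4)], [L] about [log n] and [m] about [n / (k * L)]. *)
Lemma exists_params D : 0 < D -> exists N, forall n, N <= n -> exists k L m,
  [/\ 0 < L, 0 < m, n <= k ^ 4, n <= 2 ^ L &
  3 * (k * n * L) <= m ^ 2 /\ D * (k * m * L) <= n].
Proof.
(* Here [192 = 16 * 12]: the factor 16 is lost in [kn], and 12 is needed in [big]. *)
move=> D0; have [C C0 CE] : exists2 C, 0 < C & 192 * D ^ 2 <= C.
  by exists (192 * D ^ 2); rewrite // muln_gt0 expn_gt0 D0.
have [N0 hN0] := poly_le_pow2 12 (2 * C ^ 4).
exists (2 ^ N0).+2 => n Nn.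
pose L := up_log 2 n.
have nL : n <= 2 ^ L by exact: up_logP.
have Ln : 2 ^ L.-1 < n by apply: up_log_gtn; lia.
have L0 : 0 < L by rewrite up_log_gt0; lia.
have NL : N0 <= L by rewrite -(leq_exp2l (m := 2))//; lia.
(* As [2 ^ L.-1 < n], powers of [L] are small compared with [n], hence also with [k]. *)
have CL : (C * L ^ 3) ^ 4 <= n.
  have h : 2 * (C ^ 4 * L ^ 12) <= 2 * 2 ^ L.-1.
    by rewrite mulnA -expnS prednK// hN0.
  by rewrite leq_pmul2l// in h; rewrite expnMn -expnM (leq_trans h)// ltnW.
have exk : exists k, n <= k ^ 4.
  by exists n; rewrite -[leqLHS]expn1 leq_pexp2l//; lia.
have [k nk kmin] := ex_minnP exk.
have CLk : C * L ^ 3 <= k by rewrite -(@leq_exp2r _ _ 4)// (leq_trans CL).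
have kn : k ^ 4 <= 16 * n.
  have k2 : k <= 2 * k.-1.
    suff : 1 < k by lia.
    rewrite ltnNge; apply/negP => k1.
    have : k ^ 4 <= 1 by rewrite -[leqRHS](exp1n 4) leq_exp2r.
    lia.
  apply: leq_trans (_ : _ <= (2 * k.-1) ^ 4) _; first by rewrite leq_exp2r.
  rewrite expnMn leq_mul2l /= ltnW// ltnNge; apply/negP => /kmin.
  have : 0 < C * L ^ 3 by rewrite muln_gt0 expn_gt0 C0 L0.
  lia.
have k0 : 0 < k by apply: leq_trans CLk; rewrite muln_gt0 expn_gt0 C0 L0.
pose a := k * L.
have a0 : 0 < a by rewrite muln_gt0 k0.
(* This amounts to [3 * a * n <= m ^ 2] for [m = n / (D * a)], with a factor 4 to spare for the
   rounding of [m]. *)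
have big : 12 * D ^ 2 * a ^ 3 <= n.
  rewrite -(@leq_pmul2l 16)//; apply: leq_trans kn.
  apply: leq_trans (_ : _ <= C * L ^ 3 * k ^ 3) _; last first.
    by rewrite (expnS k) leq_mul2r CLk orbT.
  rewrite /a expnMn; move: CE; move: (D ^ 2) (L ^ 3) (k ^ 3) => *; nia.
have Da : D * a <= n.
  apply: leq_trans big; have : D <= D ^ 2 by rewrite -[leqLHS]expn1 leq_pexp2l.
  have : a <= a ^ 3 by rewrite -[leqLHS]expn1 leq_pexp2l.
  move: (D ^ 2) (a ^ 3) => *; nia.
pose m := n %/ (D * a).
have Da0 : 0 < D * a by rewrite muln_gt0 D0.
have m0 : 0 < m by rewrite divn_gt0.
exists k, L, m; split => //; split; last first.
  have -> : D * (k * m * L) = m * (D * a) by rewrite (mulnAC k) mulnA mulnC.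
  exact: leq_divM.
have nm : n <= 2 * (D * a) * m.
  have := ltn_ceil n Da0; rewrite -/m; nia.
have h1 : n * n <= 4 * (D ^ 2 * a ^ 2) * m ^ 2.
  apply: leq_trans (leq_mul nm nm) _; rewrite -!expnMn; move: (D * a) => b.
  nia.
have h2 : 12 * D ^ 2 * a ^ 3 * n <= n * n by rewrite leq_mul2r big orbT.
have D2a : 0 < 4 * (D ^ 2 * a ^ 2) by rewrite -expnMn muln_gt0 expn_gt0 Da0.
rewrite -(leq_pmul2l D2a); apply: leq_trans (leq_trans h2 h1).
rewrite mulnAC -/a (expnS a 2); move: (D ^ 2) (a ^ 2) => ? ?; nia.
Qed.

(** * The weight of the colourings that satisfy a system of equations *)

Section Weights.
Local Open Scope ring_scope.
Variables (R : realDomainType) (T : finType) (wt : bool -> R) (q : R).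
Hypotheses (wt_ge0 : forall b, 0 <= wt b) (wt_le : forall b, wt b <= q)
  (wt_sum : wt true + wt false = 1).

Definition cweight (c : {ffun T -> bool}) : R := \prod_v wt (c v).

Let q_ge0 : 0 <= q. Proof. exact: le_trans (wt_ge0 true) (wt_le true). Qed.

Let cweight_ge0 c : 0 <= cweight c.
Proof. by apply: prodr_ge0 => v _; exact: wt_ge0. Qed.

Lemma sum_cweight : \sum_c cweight c = 1.
Proof.
rewrite /cweight -(bigA_distr_bigA (fun _ b => wt b)) big1// => v _.
by rewrite big_bool.
Qed.

Definition toggle (z : T) (c : {ffun T -> bool}) : {ffun T -> bool} :=
  [ffun v => c v (+) (v == z)].

Lemma toggleK z : involutive (toggle z).
Proof. by move=> c; apply/ffunP => v; rewrite !ffunE addbK. Qed.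

(** Exactly one of [c] and [toggle z c] satisfies the equation. Together they weigh [nu c], and the
    one that satisfies it has at most the fraction [q] of this. *)
Lemma sum_cweight_constraint (F : pred {ffun T -> bool}) (z z' : T) : z' != z ->
  (forall c, F (toggle z c) = F c) ->
  \sum_(c | F c && (c z == c z')) cweight c <= q * \sum_(c | F c) cweight c.
Proof.
move=> zz' Ftog; pose nu c := \prod_(v | v != z) wt (c v) : R.
have nuE c : cweight c = wt (c z) * nu c by rewrite /cweight (bigD1 z).
have nu_tog c : nu (toggle z c) = nu c.
  by apply: eq_bigr => v vz; rewrite ffunE (negbTE vz) addbF.
have -> : \sum_(c | F c) cweight c = \sum_(c | F c && (c z == c z')) nu c.
  rewrite (bigID (fun c : {ffun T -> bool} => c z == c z')) /=.
  rewrite [X in _ + X](reindex_inj (inv_inj (toggleK z))) /=.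
  rewrite [X in _ + X](eq_bigl (fun c => F c && (c z == c z'))); last first.
    move=> c; rewrite Ftog !ffunE eqxx (negbTE zz') addbF.
    by case: (c z) (c z') => -[].
  rewrite -big_split /=; apply: eq_bigr => c _.
  rewrite !nuE nu_tog -mulrDl ffunE eqxx.
  by case: (c z); rewrite /= ?wt_sum ?[wt false + _]addrC ?wt_sum mul1r.
rewrite big_distrr /=; apply: ler_sum => c _; rewrite nuE ler_wpM2r//.
by apply: prodr_ge0 => v _; exact: wt_ge0.
Qed.

(* Revealing the colours in the order of [r], each [z] in [J] has to take the
   colour of a vertex revealed before it. *)
Lemma sum_cweight_forest (J : {set T}) (Q : T -> T) (r : T -> nat) :
  {in J, forall z, (r (Q z) < r z)%N} ->
  \sum_(c : {ffun T -> bool} | [forall z in J, c z == c (Q z)]) cweight c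
    <= q ^+ #|J|.
Proof.
elim: {J}#|J| {-2}J (erefl #|J|) => [|k IH] J Jk rQ.
  rewrite Jk expr0 -sum_cweight [leRHS](bigID (fun c : {ffun T -> bool} =>
    [forall z in J, c z == c (Q z)])) /= lerDl.
  by apply: sumr_ge0 => c _; exact: cweight_ge0.
have [z0 z0J] : exists z, z \in J by apply/set0Pn; rewrite -card_gt0 Jk.
(* The [z] revealed last is not [Q z'] for any [z'] in [J], so toggling it preserves the other
   constraints. *)
case: (@arg_maxnP _ z0 (mem J) r z0J) => z /= zJ zmax.
have Jk' : #|J :\ z| = k by move: (cardsD1 z J); rewrite Jk zJ => -[].
have QJ z' : z' \in J -> Q z' != z.
  move=> z'J; apply: contraTneq (rQ _ z'J) => ->; rewrite -leqNgt; exact: zmax.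
pose F (c : {ffun T -> bool}) := [forall u in J :\ z, c u == c (Q u)].
rewrite (eq_bigl (fun c => F c && (c z == c (Q z)))); last first.
  move=> c; apply/forall_inP/andP => [h|[/forall_inP h hz] z' z'J].
    by split; [apply/forall_inP => z'; rewrite inE => /andP[_ /h]|exact: h].
  by have [->//|z'z] := eqVneq z' z; apply: h; rewrite in_setD1 z'z.
apply: (le_trans (sum_cweight_constraint (QJ z zJ) _)) => [c|].
  apply: eq_forallb_in => z'; rewrite !inE => /andP[z'z z'J].
  by rewrite !ffunE (negbTE z'z) (negbTE (QJ _ z'J)) !addbF.
rewrite Jk exprS ler_wpM2l// -Jk' IH// => z'; rewrite inE => /andP[_]; exact: rQ.
Qed.

Definition respectsb (E : rel T) (c : {ffun T -> bool}) :=
  [forall z, forall z', E z z' ==> (c z == c z')].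

Hypothesis q_le1 : q <= 1.

(** One equation [c z = c (Q z)] is kept for each moved [z]. These may form cycles; keeping only
    those where [Q z] precedes [z] leaves a forest, at the cost of half of them. *)
Lemma sum_cweight_respects (E : rel T) K : (2 * K <= #|moved E|)%N ->
  \sum_(c | respectsb E c) cweight c <= q ^+ K.
Proof.
move=> KE; pose Q z := odflt z [pick z' | E z z' && (z' != z)].
have QE z : z \in moved E -> E z (Q z) && (Q z != z).
  rewrite inE => /existsP[z' hz']; rewrite /Q.
  by case: pickP => //= /(_ z'); rewrite hz'.
have main (r : T -> nat) : (K <= #|[set z in moved E | r (Q z) < r z]|)%N ->
    \sum_(c | respectsb E c) cweight c <= q ^+ K.
  move=> Kr; set J := [set z in moved E | _] in Kr.
  apply: (@le_trans _ _ (q ^+ #|J|)); last exact: ler_wiXn2l.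
  have rJ : {in J, forall z, (r (Q z) < r z)%N}.
    by move=> z; rewrite inE => /andP[].
  apply: le_trans (sum_cweight_forest rJ).
  rewrite [leRHS](bigID (fun c => respectsb E c)) /=.
  rewrite [X in X + _](eq_bigl (fun c => respectsb E c)).
    by rewrite lerDl sumr_ge0// => c _; exact: cweight_ge0.
  move=> c; apply/andb_idl => /forallP h; apply/forall_inP => z.
  rewrite inE => /andP[/QE/andP[+ _] _].
  by have /forallP/(_ (Q z))/implyP := h z.
(* Half of the [Q z] precede [z] in the enumeration of [T], or half follow it. *)
pose r1 (z : T) : nat := enum_rank z; pose r2 (z : T) := (#|T| - r1 z)%N.
have [|l1] := leqP K #|[set z in moved E | r1 (Q z) < r1 z]|%N.
  exact: main.
apply: (main r2).
have : moved E \subset [set z in moved E | r1 (Q z) < r1 z]%N :|: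
                       [set z in moved E | r2 (Q z) < r2 z]%N.
  apply/subsetP => z zE; rewrite in_setU ![z \in [set _ in _ | _]]inE zE /=.
  have ne : r1 (Q z) != r1 z.
    by rewrite val_eqE (inj_eq enum_rank_inj); have /andP[] := QE _ zE.
  have rT u : (r1 u < #|T|)%N by exact: ltn_ord.
  move: (rT z) (rT (Q z)) ne; rewrite /r2; move: (r1 z) (r1 (Q z)) #|T|.
  by clear; lia.
move/subset_leq_card => h; rewrite leqNgt; apply/negP => l2.
have := leq_trans KE (leq_trans h (card_setU_le _ _)).
rewrite leqNgt => /negP; apply; rewrite mul2n -addnn -addSn.
exact: leq_add l1 (ltnW l2).
Qed.

Lemma sum_cweight_union (I : finType) (E : I -> rel T) K :
  \sum_(c | [exists i, (2 * K <= #|moved (E i)|)%N && respectsb (E i) c])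
    cweight c <= #|I|%:R * q ^+ K.
Proof.
apply: (@le_trans _ _ (\sum_(i | (2 * K <= #|moved (E i)|)%N)
    \sum_(c | respectsb (E i) c) cweight c)); last first.
  apply: (@le_trans _ _ (\sum_(i | (2 * K <= #|moved (E i)|)%N) q ^+ K)).
    by apply: ler_sum => i; exact: sum_cweight_respects.
  rewrite sumr_const -[_ *+ _]mulr_natl ler_wpM2r ?exprn_ge0// ler_nat.
  exact: max_card.
rewrite (exchange_big_dep predT)//= [leLHS]big_mkcond; apply: ler_sum => c _.
case: ifP => [/existsP[i /andP[Ki ri]]|_]; last first.
  by apply: sumr_ge0 => i _; exact: cweight_ge0.
rewrite (bigD1 i) ?Ki//= lerDl sumr_ge0// => j _; exact: cweight_ge0.
Qed.

End Weights.

From mathcomp Require Import all_classical all_reals all_analysis.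
Import numFieldNormedType.Exports.

(** * Balls of radius 2 in the hypercube *)

Section HypercubeBalls.
Variable n : nat.
Local Notation V := {ffun 'I_n -> bool}.
Local Notation Q := (hypercube n).
Implicit Types (x y u v : V) (a b c i j k : 'I_n).

Lemma adj_flipP x y : reflect (exists a, y = flip x a) (@adj Q x y).
Proof.
apply: (iffP idP) => [/eqP/mem_card1[a xya]|[a ->]].
  exists a; apply/ffunP => i; rewrite ffunE; have := xya i; rewrite !inE /=.
  by rewrite /in_mem /= => <-; case: (x i) (y i) => -[].
rewrite /adj /= (@fintype.eq_card1 _ a) // => i; rewrite !inE ffunE.
by case: (x i); case: (i == a).
Qed.

Local Arguments hypercube : simpl never.

Definition within2 x u :=
  [\/ u = x, exists a, u = flip x a | exists a b, u = flip (flip x a) b].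

Lemma ball_setP x u : reflect (within2 x u) (u \in @ball_set Q 2 x).
Proof.
apply: (iffP idP); rewrite inE.
  case/existsP=> k /existsP[s /andP[]]; case: k s => -[|[|[|k]]] //= kP s.
  - by rewrite (tuple0 s) /= => _ /eqP <-; constructor 1.
  - case/tupleP: s => u1 s; rewrite (tuple0 s) /= andbT.
    move=> /adj_flipP[a ->] /eqP <-.
    by constructor 2; exists a.
  - case/tupleP: s => u1 s; case/tupleP: s => u2 s; rewrite (tuple0 s) /= andbT.
    move=> /andP[/adj_flipP[a ->] /adj_flipP[b ->]] /eqP <-.
    by constructor 3; exists a, b.
have adjf y a : @adj Q y (flip y a) by apply/adj_flipP; exists a.
case=> [->|[a ->]|[a [b ->]]]; apply/existsP.
- by exists (@Ordinal 3 0 isT); apply/existsP; exists [tuple]; rewrite /= eqxx.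
- exists (@Ordinal 3 1 isT); apply/existsP; exists [tuple (flip x a : Q)].
  by apply/andP; split; [apply/andP; split; [exact: adjf|]|exact: eqxx].
- exists (@Ordinal 3 2 isT); apply/existsP.
  exists [tuple (flip x a : Q); (flip (flip x a) b : Q)].
  apply/andP; split; last exact: eqxx.
  by apply/andP; split; [|apply/andP; split]; rewrite //; exact: adjf.
Qed.

Lemma within2_agree x u i j k : within2 x u -> i != j -> i != k -> j != k ->
  u i != x i -> u j != x j -> u k != x k -> False.
Proof.
have flipE y a l : (flip y a l != y l) = (l == a).
  by rewrite ffunE; case: (y l); case: (l == a).
case=> [->|[a ->]|[a [b ->]]] ij ik jk; first by rewrite eqxx.
  by rewrite !flipE => /eqP ia /eqP ja; rewrite ia ja eqxx in ij.
have flip2E l : flip (flip x a) b l != x l -> l = a \/ l = b.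
  rewrite !ffunE; case: (eqVneq l a); first by left.
  by case: (eqVneq l b); [right|rewrite !addbF eqxx].
move=> /flip2E[] ia /flip2E[] ja /flip2E[] ka;
  by move: ij ik jk; rewrite ia ja ka !eqxx.
Qed.

Lemma exists_neq2 a b : 2 < n -> exists c, c != a /\ c != b.
Proof.
move=> n2; have [c] : exists c, c \notin [set a; b]%SET.
  by apply: exists_notin_card; rewrite card_ord cards2; case: (a != b); lia.
by rewrite !inE negb_or => /andP[]; exists c.
Qed.

(* A ball of radius 2 has only one centre, so isomorphisms of balls preserve the
   centre although this is not required of them. *)
Lemma ball2_center_unique x y : 2 < n -> within2 y x ->
  (forall u, within2 y u -> within2 x u) -> x = y.
Proof.
move=> n2 [//|[a E]|[a [b E]]] h.
  (* The vertex [y + b + c] is at distance 3 from [x = y + a]; below, [y + c] is at distance 3 from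
     [x = y + a + b]. *)
  have [b [ba _]] := exists_neq2 a a n2; have [c [ca cb]] := exists_neq2 a b n2.
  have yu : within2 y (flip (flip y b) c) by constructor 3; exists b, c.
  case: (within2_agree (h _ yu) (i := a) (j := b) (k := c)); rewrite 1?eq_sym//.
  - rewrite E !ffunE eqxx (eq_sym a b) (eq_sym a c) (negbTE ba) (negbTE ca).
    by case: (y a).
  - by rewrite E !ffunE eqxx (eq_sym b c) (negbTE cb) (negbTE ba); case: (y b).
  - by rewrite E !ffunE eqxx (negbTE cb) (negbTE ca); case: (y c).
have [ab|ab] := eqVneq a b; first by rewrite E ab flipK.
have [c [ca cb]] := exists_neq2 a b n2.
have yu : within2 y (flip y c) by constructor 2; exists c.
case: (within2_agree (h _ yu) (i := c) (j := a) (k := b)); rewrite //.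
- by rewrite E !ffunE eqxx (negbTE ca) (negbTE cb); case: (y c).
- by rewrite E !ffunE eqxx (eq_sym a c) (negbTE ca) (negbTE ab); case: (y a).
- rewrite E !ffunE eqxx (eq_sym b a) (eq_sym b c) (negbTE cb) (negbTE ab).
  by case: (y b).
Qed.

Section BallIso.
Variables (x y : V) (phi : @cball Q 2 x -> @cball Q 2 y).
Hypotheses (n2 : 2 < n) (phi_iso : graph_iso phi).

(** Extending [phi] by the identity avoids computing in the subtype of the ball. *)
Let ph u : V := if insub u is Some s then val (phi s) else u.

Let phE (s : @cball Q 2 x) : ph (val s) = val (phi s).
Proof. by rewrite /ph valK. Qed.

Let ph_within u : within2 x u -> within2 y (ph u).
Proof.
move=> /ball_setP xu; rewrite (phE (Sub u xu)).
by apply/ball_setP; exact: (valP (phi (Sub u xu))).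
Qed.

Let ph_adj u v : within2 x u -> within2 x v -> @adj Q (ph u) (ph v) = @adj Q u v.
Proof.
move=> /ball_setP xu /ball_setP xv; rewrite (phE (Sub u xu)) (phE (Sub v xv)).
exact: (phi_iso.2 (Sub u xu) (Sub v xv)).
Qed.

Let ph_inj u v : within2 x u -> within2 x v -> ph u = ph v -> u = v.
Proof.
move=> /ball_setP xu /ball_setP xv; rewrite (phE (Sub u xu)) (phE (Sub v xv)).
by move=> /val_inj /(bij_inj phi_iso.1) /(congr1 val).
Qed.

Let ph_surj u : within2 y u -> exists2 v, within2 x v & ph v = u.
Proof.
move=> /ball_setP yu; have [psi _ psiK] := phi_iso.1.
exists (val (psi (Sub u yu))); last by rewrite phE psiK.
by apply/ball_setP; exact: (valP (psi (Sub u yu))).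
Qed.

Let in0 : within2 x x. Proof. by constructor 1. Qed.
Let in1 a : within2 x (flip x a). Proof. by constructor 2; exists a. Qed.
Let in2 a b : within2 x (flip (flip x a) b).
Proof. by constructor 3; exists a, b. Qed.

Let ph_flip u a : within2 x u -> within2 x (flip u a) ->
  exists i, ph (flip u a) = flip (ph u) i.
Proof.
move=> xu xua; apply/adj_flipP; rewrite ph_adj//.
by apply/adj_flipP; exists a.
Qed.

Let ph_center : ph x = y.
Proof.
apply: ball2_center_unique => // [|u /ph_surj[v xv <-]]; first exact: ph_within.
case: (xv) => [->|[a va]|[a [b vb]]]; first by constructor 1.
  have [i ->] : exists i, ph v = flip (ph x) i by rewrite va; exact: ph_flip.
  by constructor 2; exists i.
have [i vi] := ph_flip in0 (in1 a).
have [j vj] := ph_flip (in1 a) (in2 a b).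
by constructor 3; exists i, j; rewrite vb vj vi.
Qed.

(** The images of the neighbours of [x] define [r]. As [x + a + b] is the common neighbour of
    [x + a] and [x + b] other than [x], its image is the one of [y + r a] and [y + r b] other than
    [y]. *)
Lemma ball_iso_perm : exists r : 'I_n -> 'I_n, injective r /\
  forall s : @cball Q 2 x,
  [/\ val s = x -> val (phi s) = y,
     forall a, val s = flip x a -> val (phi s) = flip y (r a)
   & forall a b, a != b -> val s = flip (flip x a) b ->
       val (phi s) = flip (flip y (r a)) (r b)].
Proof.
pose r a := odflt a [pick i | ph (flip x a) == flip y i].
have rE a : ph (flip x a) = flip y (r a).
  have [i vi] := ph_flip in0 (in1 a); rewrite ph_center in vi.
  by rewrite /r; case: pickP => [j /eqP//|/(_ i)]; rewrite vi eqxx.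
have rI : injective r.
  move=> a b e; have /ph_inj : ph (flip x a) = ph (flip x b) by rewrite !rE e.
  by move=> /(_ (in1 a) (in1 b)) /flip_injr.
exists r; split => // s; split.
- by rewrite -phE => ->; exact: ph_center.
- by move=> a; rewrite -phE => ->; exact: rE.
move=> a b ab; rewrite -phE => ->.
have [i vi] := ph_flip (in1 a) (in2 a b).
have [j vj] : exists j, ph (flip (flip x a) b) = flip (ph (flip x b)) j.
  by rewrite flipC; apply: ph_flip => //; rewrite flipC.
have := vj; rewrite vi !rE => /flip2_eqP[] [].
- move=> rai _; move: vi; rewrite rE rai flipK -ph_center.
  move=> /ph_inj - /(_ (in2 a b) in0) /(congr1 (fun z : V => flip z b)).
  rewrite flipK => /flip_injr e.
  by rewrite e eqxx in ab.
- by move=> /rI e; rewrite e eqxx in ab.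
- by move=> _ ->; [].
Qed.

End BallIso.

Definition chart (chi lambda : V -> bool) x y (r : 'I_n -> 'I_n) :=
  [/\ injective r, lambda x = chi y,
      forall a, lambda (flip x a) = chi (flip y (r a))
    & forall a b, a != b ->
        lambda (flip (flip x a) b) = chi (flip (flip y (r a)) (r b))].

(** The given isomorphism goes from the ball around [g x] to the one around [x]; a chart goes the
    other way, hence the inverse permutation [invF rI]. *)
Lemma locally_equiv_chart (chi lambda : Q -> bool) : 2 < n ->
  locally_equiv 2 chi lambda -> exists f g : V -> V,
    [/\ cancel f g, cancel g f & forall x, exists r, chart chi lambda x (g x) r].
Proof.
move=> n2 [f [[g fK gK] fP]]; exists f, g; split => // x.
have := fP (g x); rewrite gK => -[phi [phi_iso chiE]].
have [r [rI rP]] := ball_iso_perm n2 phi_iso.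
have chiE' s : chi (val s) = lambda (val (phi s)).
  by rewrite -[LHS]/(local_col _ s) chiE.
have inB u : within2 (g x) u -> exists s : @cball Q 2 (g x), val s = u.
  by move=> /ball_setP h; exists (Sub u h).
exists (invF rI); split.
- exact: can_inj (f_invF rI).
- have [|s sE] := inB (g x); first by constructor 1.
  by rewrite -sE chiE'; have [->] := rP s.
- move=> a; have [|s sE] := inB (flip (g x) (invF rI a)).
    by constructor 2; exists (invF rI a).
  rewrite -sE chiE'; have [_ h _] := rP s.
  by rewrite (h _ sE) f_invF.
- move=> a b ab.
  have [|s sE] := inB (flip (flip (g x) (invF rI a)) (invF rI b)).
    by constructor 3; exists (invF rI a), (invF rI b).
  rewrite -sE chiE'; have [_ _ h] := rP s.
  by rewrite (h _ _ _ sE) ?f_invF// (inj_eq (can_inj (f_invF rI))).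
Qed.

(** Preserving edges suffices: the [n] neighbours of [u] go injectively to the [n] neighbours of
    [g u], so [g] reflects edges as well. *)
Lemma distinguishable_of_flip (chi : Q -> bool) : 2 < n ->
  (forall (lambda : Q -> bool) (g : V -> V) (r : V -> 'I_n -> 'I_n),
    injective g -> (forall x, chart chi lambda x (g x) (r x)) ->
    forall x a, exists i, g (flip x a) = flip (g x) i) ->
  distinguishable 2 chi.
Proof.
move=> n2 h [lambda [loc]]; apply.
have [f [g [fK gK /choice[r rP]]]] := locally_equiv_chart n2 loc.
have gI := can_inj gK.
have gflip := h lambda g r gI rP.
exists f; split; last first.
  by apply/funext => v /=; have [_ -> _ _] := rP (f v); rewrite fK.
split; first by exists g.
suff gadj u v : @adj Q (g u) (g v) = @adj Q u v.
  by move=> u v; rewrite -gadj !fK.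
have [s sE] := choice (gflip u).
have sI : injective s.
  move=> a b e; have /gI : g (flip u a) = g (flip u b) by rewrite !sE e.
  exact: flip_injr.
apply/adj_flipP/adj_flipP => -[a].
  by rewrite -(f_invF sI a) -sE => /gI ->; exists (invF sI a).
by move=> ->; exists (s a).
Qed.

End HypercubeBalls.

(** * The union bound *)

Section Rigid.
Variable n : nat.
Local Notation V := {ffun 'I_n -> bool}.
Local Notation Q := (hypercube n).

(** In [local_star] with [w a = g (x + a)], both sides of [chi_w] are [lambda (x + a + b + c)] and
    both sides of [chi_v] are [lambda (x + a + b)]. *)
Lemma distinguishable_of_rigid (chi : Q -> bool) m :
  0 < m -> 2000 * (100 * m) <= n ->
  (forall (w : 'I_n -> V) (pi : 'I_n -> 'I_n -> 'I_n),
    respects (star_rel w pi) chi -> #|moved (star_rel w pi)| < 2 * n * m ^ 2) ->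
  (forall (z z' : V) (rho sigma : 'I_n -> 'I_n) (tau : 'I_n -> option 'I_n)
    (B : {set 'I_n}) (X : {set 'I_n * 'I_n}),
    #|X| <= 20 * n * m + 2 * n ->
    respects (frame_rel z z' rho sigma tau B X) chi ->
    4 * #|moved (frame_rel z z' rho sigma tau B X)| < n ^ 2) ->
  distinguishable 2 chi.
Proof.
move=> m0 nm hstar hframe; apply: distinguishable_of_flip => [|lambda g r gI rP x].
  lia.
have rI y : injective (r y) by have [] := rP y.
apply: (local_star hstar hframe m0 nm (w := fun a => g (flip x a))
  (pi := fun a => r (flip x a)) (v := g x) (pv := r x)) => //.
- by move=> a b /gI /flip_injr.
- move=> a b c ab ac bc.
  have [_ _ _ <-//] := rP (flip x a); have [_ _ _ <-//] := rP (flip x b).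
  by rewrite (flipC x a b).
- move=> a b ab; have [_ _ _ <-//] := rP x.
  by have [_ _ <- _] := rP (flip x a).
Qed.

(* Finite encodings of the parameters of [star_rel] and [frame_rel]. The set [X]
   is given by a list of at most [s] pairs, as arbitrary sets of pairs would be
   too many. *)
Definition star_config : finType :=
  ({ffun 'I_n -> V} * {ffun 'I_n -> {ffun 'I_n -> 'I_n}})%type.

Definition star_config_rel (i : star_config) : rel V :=
  star_rel (fun a => i.1 a) (fun a b => i.2 a b).

Definition frame_config s : finType :=
  (V * V * ({ffun 'I_n -> 'I_n} * {ffun 'I_n -> 'I_n}) *
   ({ffun 'I_n -> option 'I_n} * {set 'I_n} *
    {ffun 'I_s -> option ('I_n * 'I_n)}))%type.

Definition some_values s (h : {ffun 'I_s -> option ('I_n * 'I_n)}) :=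
  [set p | [exists i, h i == Some p]]%SET.

Definition frame_config_rel s (i : frame_config s) : rel V :=
  let: (z, z', (rho, sigma), (tau, B, h)) := i in
  frame_rel z z' rho sigma tau B (some_values h).

Lemma star_config_relE (w : 'I_n -> V) (pi : 'I_n -> 'I_n -> 'I_n) :
  star_config_rel ([ffun a => w a], [ffun a => [ffun b => pi a b]])
    = star_rel w pi.
Proof.
have e1 : (fun a => [ffun a => w a] a) = w by apply/funext => a; rewrite ffunE.
have e2 : (fun a b => [ffun a => [ffun b => pi a b]] a b) = pi.
  by apply/funext => a; apply/funext => b; rewrite !ffunE.
by rewrite -[in RHS]e1 -[in RHS]e2.
Qed.

Lemma frame_config_relE s (z z' : V) (rho sigma : 'I_n -> 'I_n)
    (tau : 'I_n -> option 'I_n) (B : {set 'I_n})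
    (h : {ffun 'I_s -> option ('I_n * 'I_n)}) :
  frame_config_rel (z, z', ([ffun b => rho b], [ffun b => sigma b]),
    ([ffun b => tau b], B, h)) = frame_rel z z' rho sigma tau B (some_values h).
Proof.
have e (U : Type) (f : 'I_n -> U) : [ffun b => f b] = f :> (_ -> _).
  by apply/funext => a; rewrite ffunE.
by rewrite /frame_config_rel !e.
Qed.

Lemma some_values_surj s (X : {set 'I_n * 'I_n}) : #|X| <= s ->
  exists h : {ffun 'I_s -> option ('I_n * 'I_n)}, some_values h = X.
Proof.
move=> Xs; pose f (i : nat) := nth None [seq Some p | p <- enum X] i.
exists [ffun i : 'I_s => f i]; apply/setP => p; rewrite inE.
apply/existsP/idP => [[i]|pX].
  rewrite ffunE /f => /eqP ip.
  have iX : i < size (enum X).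
    rewrite ltnNge; apply/negP => Xi.
    by move: ip; rewrite nth_default ?size_map.
  move: ip; rewrite (nth_map p)// => -[<-].
  by rewrite -mem_enum mem_nth.
have pi : index p (enum X) < s.
  by rewrite (leq_trans _ Xs)// cardE index_mem mem_enum.
exists (Ordinal pi); rewrite ffunE /f (nth_map p) ?index_mem ?mem_enum//=.
by rewrite nth_index ?mem_enum.
Qed.

Lemma expn_le_pow2 a L e : a <= 2 ^ L -> a ^ e <= 2 ^ (L * e).
Proof. by move=> aL; rewrite expnM; case: e => // e; rewrite leq_exp2r. Qed.

Lemma card_star_config L : n <= 2 ^ L ->
  #|star_config| <= 2 ^ (n * n + L * (n * n)).
Proof.
move=> nL; rewrite card_prod !card_ffun card_bool !card_ord expnD -!expnM.
by rewrite leq_mul// expn_le_pow2.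
Qed.

Lemma card_frame_config s L : n <= 2 ^ L ->
  #|frame_config s| <= 2 ^ (4 * n + 3 * (L * n) + (2 * L).+1 * s).
Proof.
move=> nL.
have n1 : n.+1 <= 2 ^ L.+1.
  by rewrite expnS mul2n -addnn -addn1 leq_add// expn_gt0.
have n2 : (n * n).+1 <= 2 ^ (2 * L).+1.
  rewrite expnS mul2n -addnn -addn1 leq_add// ?expn_gt0//.
  by rewrite mul2n -addnn expnD leq_mul.
have cardset : #|{set 'I_n}| = 2 ^ n.
  by rewrite -cardsT -powersetT card_powerset cardsT card_ord.
rewrite !card_prod cardset !card_ffun !card_option card_prod card_bool !card_ord.
apply: leq_trans (_ : _ <= 2 ^ n * 2 ^ n * (2 ^ (L * n) * 2 ^ (L * n)) *
  (2 ^ (L.+1 * n) * 2 ^ n * 2 ^ ((2 * L).+1 * s))) _.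
  by rewrite !leq_mul// expn_le_pow2.
rewrite -!expnD leq_exp2l//; lia.
Qed.

Section Sum.
Local Open Scope ring_scope.
Variables (R : realFieldType) (wt : bool -> R) (q : R) (k L m : nat).
Hypotheses (wt_ge0 : forall b, 0 <= wt b) (wt_le : forall b, wt b <= q)
  (wt_sum : wt true + wt false = 1) (q_le1 : q <= 1) (qk : q ^+ k <= 2^-1).
Hypotheses (nL : (n <= 2 ^ L)%N) (L0 : (0 < L)%N) (m0 : (0 < m)%N)
  (nm : (2000 * (100 * m) <= n)%N) (knL : (3 * (k * n * L) <= m ^ 2)%N)
  (kmL : (600 * (k * m * L) <= n)%N).

Let q_ge0 : 0 <= q. Proof. exact: le_trans (wt_ge0 true) (wt_le true). Qed.

(** Every [k] equations gain a factor [1 / 2]; [e] such factors pay for the number of systems and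
    [n] remain. *)
Let small (N e K : nat) : (N <= 2 ^ e)%N -> (k * (e + n) <= K)%N ->
  N%:R * q ^+ K <= 2^-1 ^+ n.
Proof.
move=> Ne eK; apply: (@le_trans _ _ ((2 ^ e)%:R * (2^-1) ^+ (e + n))).
  rewrite ler_pM ?ler0n ?exprn_ge0 ?ler_nat//.
  apply: (le_trans (ler_wiXn2l q_ge0 q_le1 eK)).
  by rewrite exprM lerXn2r ?nnegrE ?exprn_ge0// invr_ge0.
by rewrite exprD mulrA natrX -exprMn divff ?expr1n ?mul1r// pnatr_eq0.
Qed.

Lemma sum_not_distinguishable :
  \sum_(c : {ffun V -> bool} | ~~ `[< distinguishable 2 (c : Q -> bool) >])
    cweight wt c <= 2 * 2^-1 ^+ n.
Proof.
pose s := (20 * n * m + 2 * n)%N.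
(* Half of the thresholds in [distinguishable_of_rigid], since [sum_cweight_union] asks for [2 * K]
   moved vertices. *)
pose K1 := (n * m ^ 2)%N; pose K2 := (n ^ 2 %/ 8)%N.
pose bad1 (c : {ffun V -> bool}) := [exists i : star_config,
  (2 * K1 <= #|moved (star_config_rel i)|)%N &&
  respectsb (star_config_rel i) c].
pose bad2 (c : {ffun V -> bool}) := [exists i : frame_config s,
  (2 * K2 <= #|moved (frame_config_rel i)|)%N &&
  respectsb (frame_config_rel i) c].
have cw0 (c : {ffun V -> bool}) : 0 <= cweight wt c by apply: prodr_ge0.
have sum1 : \sum_(c | bad1 c) cweight wt c <= 2^-1 ^+ n.
  apply: le_trans (sum_cweight_union wt_ge0 wt_le wt_sum q_le1 _ _) _.
  apply: small (card_star_config nL) _; rewrite /K1.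
  nia.
have sum2 : \sum_(c | bad2 c) cweight wt c <= 2^-1 ^+ n.
  apply: le_trans (sum_cweight_union wt_ge0 wt_le wt_sum q_le1 _ _) _.
  apply: small (card_frame_config s nL) _; rewrite /K2 leq_divRL// /s.
  (* The exponent of [card_frame_config] plus [n] is at most [74 * n * m * L], and [8 * 74 <= 600],
     the constant of [kmL]. *)
  nia.
rewrite mulr_natl mulr2n; apply: le_trans (lerD sum1 sum2).
rewrite big_mkcond [X in X + _]big_mkcond [X in _ + X]big_mkcond /= -big_split /=.
apply: ler_sum => c _.
case: ifPn => [/asboolPn nd|_]; last first.
  by case: ifP; case: ifP; rewrite ?addr0 ?add0r ?addr_ge0.
suff /orP[] : bad1 c || bad2 c.
- by move=> ->; case: ifP; rewrite ?addr0// lerDl.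
- by move=> ->; case: ifP; rewrite ?add0r// lerDr.
apply: contra_notT nd; rewrite negb_or => /andP[nb1 nb2].
have respP (E : rel V) : respects E c -> respectsb E c.
  move=> h; apply/forallP => z; apply/forallP => z'; apply/implyP => zz'.
  by apply/eqP; exact: h.
apply: (distinguishable_of_rigid m0 nm) => [w pi wr|z z' rho sigma tau B X Xs wr].
  rewrite ltnNge; apply: contra nb1 => K1w; apply/existsP.
  exists ([ffun a => w a], [ffun a => [ffun b => pi a b]]).
  rewrite star_config_relE (respP _ wr) andbT /K1 mulnA; exact: K1w.
rewrite ltnNge; apply: contra nb2 => K2w; apply/existsP.
have [h hX] := some_values_surj Xs.
exists (z, z', ([ffun b => rho b], [ffun b => sigma b]),
  ([ffun b => tau b], B, h)).
rewrite frame_config_relE hX (respP _ wr) andbT /K2; move: K2w; move: (#|_|) => M.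
have := leq_divM (n ^ 2) 8; lia.
Qed.

End Sum.

End Rigid.

(** * Random colourings *)

Local Open Scope classical_set_scope.
Local Open Scope ring_scope.

Definition colour_prob (R : realType) (p : R) (b : bool) :=
  if b then 1 - p else p.

Section RandomColouring.
Context {d : measure_display} {T : measurableType d} {R : realType}.
Variables (P : probability T R) (G : sgraph) (p : R) (chi : G -> {RV P >-> bool}).
Hypothesis chi_random : random_colouring p chi.

Let cyl (c : {ffun G -> bool}) : set T := [set w | forall v, chi v w = c v].

Let cylE c : cyl c = \bigcap_(v in [set` [set: G]%SET]) (chi v @^-1` [set c v]).
Proof.
by apply/seteqP; split => [w h v _|w h v] /=; [exact: h|apply: h; rewrite /= inE].
Qed.

Let measurable_cyl c : measurable (cyl c).
Proof.
rewrite cylE; apply: fin_bigcap_measurable => [|v _]; first exact: finite_finset.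
by apply: measurable_funPTI.
Qed.

Let prob_cyl c : P (cyl c) = (cweight (colour_prob p) c)%:E.
Proof.
have [indep marg] := chi_random.
rewrite cylE (indep _ (fun v => [set c v])) //.
rewrite /cweight -prodEFin; apply: eq_big => [v|v _]; first by rewrite inE.
by have [h1 h2] := marg v; case: (c v).
Qed.

(** The event is a finite disjoint union of cylinders, one for each colouring in [B]. *)
Lemma random_colouring_event (B : pred {ffun G -> bool}) :
  measurable [set w | B [ffun v => chi v w]] /\
  P [set w | B [ffun v => chi v w]] =
    (\sum_(c | B c) cweight (colour_prob p) c)%:E.
Proof.
have -> : [set w | B [ffun v => chi v w]] = \bigcup_(c in [set` enum B]) cyl c.
  apply/seteqP; split => [w /= Bw|w [c /= Bc cw]].
    by exists [ffun v => chi v w]; rewrite /= ?mem_enum// => v; rewrite ffunE.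
  have -> : [ffun v => chi v w] = c by apply/ffunP => v; rewrite ffunE cw.
  by rewrite mem_enum in Bc.
split; first by apply: fin_bigcup_measurable => //; exact: finite_seq.
rewrite measure_fin_bigcup//; last first.
  by move=> c c' _ _ [w [cw c'w]]; apply/ffunP => v; rewrite -cw -c'w.
rewrite -fsbig_seq ?enum_uniq// big_enum /= -sumEFin.
by apply: eq_bigr => c _; exact: prob_cyl.
Qed.

End RandomColouring.

(** * Estimates for [p] and the limit *)

Lemma inv_root4_powR (R : realType) (eps : R) (n k : nat) : 0 < eps ->
  (0 < n)%N -> (n <= k ^ 4)%N -> k%:R^-1 <= n%:R `^ (- (1 / 4) + eps).
Proof.
move=> e0 n0 nk.
have n1 : 1 <= n%:R :> R by rewrite ler1n.
have k0 : (0 < k)%N.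
  by rewrite lt0n; apply: contraTneq nk => ->; rewrite -ltnNge.
apply: (@le_trans _ _ (n%:R `^ (- (1 / 4)))); last first.
  by apply: ler_powR => //; rewrite lerDl ltW.
rewrite powRN lef_pV2 ?posrE ?powR_gt0 ?ltr0n//.
have kE : k%:R = (k ^ 4)%:R `^ (1 / 4) :> R.
  rewrite natrX -powR_mulrn ?ler0n// -powRrM.
  by rewrite (_ : 4%:R * (1 / 4) = 1 :> R) ?powRr1 ?ler0n//; field.
by rewrite kE ge0_ler_powR ?nnegrE ?ler0n ?ler_nat//; lra.
Qed.

(** The product with [(1 + p) ^+ k] is at most 1, and Bernoulli's inequality gives
    [(1 + p) ^+ k >= 1 + k * p >= 2]. *)
Lemma expr_1sub_le_half (R : realFieldType) (p : R) (k : nat) :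
  0 < p <= 1 -> k%:R^-1 <= p -> (0 < k)%N -> (1 - p) ^+ k <= 2^-1.
Proof.
move=> /andP[p0 p1] kp k0.
have k0' : 0 < k%:R :> R by rewrite ltr0n.
have kp1 : 1 <= k%:R * p.
  by rewrite -(@ler_pM2l _ k%:R)// mulfV ?gt_eqF// in kp.
have bern j : 1 + j%:R * p <= (1 + p) ^+ j.
  elim: j => [|j IH]; first by rewrite mul0r addr0 expr0.
  rewrite exprS; apply: le_trans (ler_wpM2l _ IH); last by lra.
  have : 0 <= j%:R * p * p by rewrite !mulr_ge0 ?ler0n ?ltW.
  by rewrite -natr1; lra.
have h : (1 - p) ^+ k * (1 + p) ^+ k <= 1.
  by rewrite -exprMn exprn_ile1//; nra.
have := bern k; have : 0 <= (1 - p) ^+ k by rewrite exprn_ge0//; lra.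
move: h; move: ((1 - p) ^+ k) ((1 + p) ^+ k) => x y; nra.
Qed.

Theorem theorem1p4 (R : realType) (eps : R) (p : nat -> R)
    (d : nat -> measure_display) (T : forall n : nat, measurableType (d n))
    (P : forall n : nat, probability (T n) R)
    (chi : forall n : nat, hypercube n -> {RV (P n) >-> bool}) :
  0 < eps ->
  (forall n : nat, 0 < p n <= 1 / 2) ->
  (\forall n \near \oo, n%:R `^ (- (1 / 4) + eps) <= p n) ->
  (forall n : nat, random_colouring (p n) (chi n)) ->
  (fun n : nat =>
     P n [set w : T n | distinguishable 2 (fun v : hypercube n => chi n v w)])
    @ \oo --> 1%E.
Proof.
move=> eps0 p_half p_ge chi_random.
(* The constant serves both [nm] and [kmL] of [sum_not_distinguishable]. *)
have D0 : (0 < 2000 * 100)%N by rewrite muln_gt0.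
have [N hN] := exists_params D0.
pose S n :=
  [set w : T n | distinguishable 2 (fun v : hypercube n => chi n v w)].
pose D n (c : {ffun hypercube n -> bool}) :=
  `[< distinguishable 2 (c : hypercube n -> bool) >].
have SE n : S n = [set w | D n [ffun v => chi n v w]].
  apply/funext => w; apply/propext; rewrite /S /D /=.
  have -> : ([ffun v => chi n v w] : {ffun hypercube n -> bool}) =
      (fun v => chi n v w) :> (_ -> _).
    by apply/funext => v; rewrite ffunE.
  by split => /asboolP.
have mS n : measurable (S n).
  by rewrite SE; have [] := random_colouring_event (chi_random n) (D n).
have lower : \forall n \near \oo,
    ((1 - 2 * 2^-1 ^+ n)%R%:E <= P n (S n) <= 1)%E.
  near=> n.
  have [k [L [m [L0 m0 nk nL [knL kmL]]]]] : exists k L m,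
    [/\ (0 < L)%N, (0 < m)%N, (n <= k ^ 4)%N, (n <= 2 ^ L)%N &
    (3 * (k * n * L) <= m ^ 2)%N /\ (2000 * 100 * (k * m * L) <= n)%N].
    by apply: hN; near: n; exact: nbhs_infty_ge.
  have n0 : (0 < n)%N by near: n; exact: nbhs_infty_ge.
  have k0 : (0 < k)%N.
    by rewrite lt0n; apply: contraTneq nk => ->; rewrite -ltnNge.
  have pn : n%:R `^ (- (1 / 4) + eps) <= p n by near: n.
  have kp := le_trans (inv_root4_powR eps0 n0 nk) pn.
  have /andP[p0 p12] := p_half n.
  have p01 : 0 < p n <= 1 by lra.
  have kmL0 : (m <= k * m * L)%N.
    by rewrite mulnAC mulnC leq_pmulr// muln_gt0 k0.
  have [mC PC] := random_colouring_event (chi_random n) (fun c => ~~ D n c).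
  apply/andP; split; last exact: probability_le1.
  rewrite -[S n]setCK probability_setC; last exact: measurableC.
  have -> : ~` S n = [set w | ~~ D n [ffun v => chi n v w]].
    by rewrite SE; apply/seteqP; split => w /= /negP.
  rewrite PC -EFinB lee_fin lerB//.
  (* Since [p n <= 1 / 2], no colour is likelier than [1 - p n], which serves as [q]. *)
  apply: (@sum_not_distinguishable n R (colour_prob (p n)) (1 - p n) k L m) => //.
  - by case; rewrite /colour_prob; lra.
  - by case; rewrite /colour_prob; lra.
  - by rewrite /colour_prob subrK.
  - by rewrite lerBlDr lerDl ltW.
  - exact: expr_1sub_le_half.
  - by rewrite mulnA (leq_trans _ kmL)// leq_pmul2l.
  - by rewrite (leq_trans _ kmL)// leq_mul2r; apply/orP; right; lia.
apply: (squeeze_cvge lower); last exact: cvg_cst.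
apply: cvg_EFin; first by apply: nearW => n.
rewrite [X in _ --> X](_ : _ = 1 - 2 * 0); last by rewrite mulr0 subr0.
apply: cvgB; first exact: cvg_cst.
apply: cvgM; first exact: cvg_cst.
by apply: cvg_expr; rewrite ger0_norm ?invr_ge0// invf_lt1// ltr1n.
Unshelve. all: by end_near.
Qed.
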